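(* Let $K$ be a virtual knot and let $P_K$ be its affine index polynomial. Write $P_K=(t-1)\sum_{n\in\mathbb{Z}}a_n t^n$ with integers $a_n$ (only finitely many nonzero). Then \[F_d(K)\ \ge\ \frac{\sum_{n\in\mathbb{Z}}|a_n|}{2}.\]
   Context: Virtual knots are equivalence classes of virtual knot diagrams (or Gauss diagrams) under classical and virtual Reidemeister moves. A Gauss diagram is an oriented circle with signed arrows, one per real crossing, from the over-crossing preimage to the under-crossing preimage, signed by the crossing sign $\varepsilon(\gamma)=\pm1$. A forbidden detour move is the local move on virtual knot diagrams whose effect on Gauss diagrams is to exchange the positions of an arrow head and an arrow tail (of different arrows) that are adjacent on the circle, keeping signs. Every virtual knot diagram can be turned into the trivial (crossingless) diagram by Reidemeister moves, virtual Reidemeister moves and forbidden detour moves; the forbidden detour number $F_d(K)$ is the minimal number of forbidden detour moves needed to transform a diagram of $K$ into the trivial knot diagram (Reidemeister and virtual Reidemeister moves being free). Affine index polynomial: for an arrow $\gamma=\overrightarrow{PQ}$ give its endpoints signs $\varepsilon(P)=-\varepsilon(\gamma)$, $\varepsilon(Q)=\varepsilon(\gamma)$; the index $i(\gamma)$ is the sum of the signs of all arrow endpoints, other than $P,Q$, lying on the arc of the circle from $P$ to $Q$ in the direction of the circle's orientation. Set $J_n(K)=\sum_{i(\gamma)=n}\varepsilon(\gamma)$ for $n\neq0$ and $P_K=\sum_{n\in\mathbb{Z}}J_n(K)(t^{-n}-1)$, a Laurent polynomial invariant of $K$ (equal to Kauffman's affine index polynomial); note $P_K(1)=0$, so it is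 divisible by $t-1$. *)

(* Defs.v *)
From mathcomp Require Import all_boot all_order all_algebra.
Set Implicit Arguments. Unset Strict Implicit. Unset Printing Implicit Defensive.
Import Order.TTheory GRing.Theory Num.Theory.

(* An arrow endpoint on the oriented circle, read in the circle's direction:
   (label of the arrow, is it the head (= under-crossing preimage)?,
    is the sign of the arrow +1 ?).  A Gauss diagram is the cyclic sequence of
   its arrow endpoints, i.e. a word up to rotation (rotation is a free move). *)
Definition letter := (nat * bool * bool)%type.
Definition lab (x : letter) : nat := x.1.1.
Definition ishead (x : letter) : bool := x.1.2.
Definition pos (x : letter) : bool := x.2.
Definition gword := seq letter.

Definition wf_gauss (w : gword) : Prop :=
  forall x, x \in w ->
    count (fun y => lab y == lab x) w = 2%N /\ (lab x, ~~ ishead x, pos x) \in w.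

Definition labels (w : gword) : seq nat := map lab w.

Definition bsgn (b : bool) : int := if b then 1%R else (-1)%R.
Definition end_sgn (x : letter) : int :=
  if ishead x then bsgn (pos x) else (- bsgn (pos x))%R.

(* index i(gamma) of the arrow labelled l: sum of the endpoint signs strictly
   between its tail P and its head Q, going from P to Q along the circle. *)
Definition arrow_index (w : gword) (l : nat) : int :=
  let r := rot (find (fun x => (lab x == l) && ~~ ishead x) w) w in
  let j := find (fun x => (lab x == l) && ishead x) r in
  (\sum_(x <- take j.-1 (behead r)) end_sgn x)%R.

(* J_n(K) = sum of eps(gamma) over arrows with i(gamma) = n (arrows are
   enumerated through their tails). *)
Definition Jn (w : gword) (n : int) : int :=
  (\sum_(x <- w | ~~ ishead x && (arrow_index w (lab x) == n)) bsgn (pos x))%R.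

(* coefficient of t^k in P_K = sum_{n <> 0} J_n (t^{-n} - 1) *)
Definition affine_coef (w : gword) (k : int) : int :=
  if k == 0%R then
    (- \sum_(x <- w | ~~ ishead x && (arrow_index w (lab x) != 0%R)) bsgn (pos x))%R
  else Jn w (- k)%R.

(* virtual Reidemeister moves do not change the Gauss diagram *)

Definition R1_ins (w w' : gword) : Prop :=
  exists u v (l : nat) (e : bool),
    w = u ++ v /\ l \notin labels w /\
    (w' = u ++ [:: (l, false, e); (l, true, e)] ++ v \/
     w' = u ++ [:: (l, true, e); (l, false, e)] ++ v).

Definition R2_ins (w w' : gword) : Prop :=
  exists u v z (a b : nat) (e : bool),
    w = u ++ v ++ z /\ a != b /\ a \notin labels w /\ b \notin labels w /\
    let ta := (a, false, e) in let tb := (b, false, ~~ e) in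
    let ha := (a, true, e) in let hb := (b, true, ~~ e) in
    exists S1 S2,
      (w' = u ++ S1 ++ v ++ S2 ++ z) /\
      ((S1 = [:: ta; tb] /\ S2 = [:: ha; hb]) \/
       (S1 = [:: ta; tb] /\ S2 = [:: hb; ha]) \/
       (S1 = [:: ha; hb] /\ S2 = [:: ta; tb]) \/
       (S1 = [:: ha; hb] /\ S2 = [:: tb; ta])).

(* R3: three arrows a (top over middle), b (top over bottom),
   c (middle over bottom) on three segments T, M, B; the move reverses the
   order of the two endpoints on each segment.  sT : a before b on T,
   sM : a before c on M, sB : b before c on B.  The configurations arising
   from a triangle of three oriented strands are exactly those with
   eps(a)eps(b) = sM*sB and eps(a)eps(c) = sT*sB. *)
Definition R3_move (w w' : gword) : Prop :=
  exists (a b c : nat) (ea eb ec sT sM sB : bool),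
    [&& a != b, a != c & b != c] /\
    (ea == eb) = (sM == sB) /\ (ea == ec) = (sT == sB) /\
    let ST := if sT then [:: (a, false, ea); (b, false, eb)]
                    else [:: (b, false, eb); (a, false, ea)] in
    let SM := if sM then [:: (a, true, ea); (c, false, ec)]
                    else [:: (c, false, ec); (a, true, ea)] in
    let SB := if sB then [:: (b, true, eb); (c, true, ec)]
                    else [:: (c, true, ec); (b, true, eb)] in
    exists x1 x2 x3 x4 P Q R,
      perm_eq [:: P; Q; R] [:: ST; SM; SB] /\
      w = x1 ++ P ++ x2 ++ Q ++ x3 ++ R ++ x4 /\
      w' = x1 ++ rev P ++ x2 ++ rev Q ++ x3 ++ rev R ++ x4.

(* rotation of the circle's starting point and renaming of arrows do not
   change the Gauss diagram *)
Definition rot_move (w w' : gword) : Prop := exists k, w' = rot k w.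
Definition relabel_move (w w' : gword) : Prop :=
  exists f : nat -> nat, injective f /\
    w' = map (fun x => (f (lab x), ishead x, pos x)) w.

Definition R_step (w w' : gword) : Prop :=
  R1_ins w w' \/ R2_ins w w' \/ R3_move w w' \/ rot_move w w' \/ relabel_move w w'.

Definition free_move (w w' : gword) : Prop := R_step w w' \/ R_step w' w.

Definition fd_move (w w' : gword) : Prop :=
  exists u v (x y : letter),
    lab x != lab y /\ ishead x != ishead y /\
    w = u ++ [:: x; y] ++ v /\ w' = u ++ [:: y; x] ++ v.

Inductive fd_reach : gword -> gword -> nat -> Prop :=
| fd_refl w : fd_reach w w 0
| fd_free w w' z n : free_move w w' -> fd_reach w' z n -> fd_reach w z n
| fd_fd w w' z n : fd_move w w' -> fd_reach w' z n -> fd_reach w z n.+1.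

(* Main.v *)
(** Fix a base point and let [height y] be the sum of the endpoint signs before
    the endpoint [y].  Since all endpoint signs add up to 0, the index of an
    arrow of sign e is height(head) - height(tail) + e.  A crossing of index n
    contributes e (t^-n - 1), and the coefficient of t^k in
    (t^-n - 1) / (t - 1) is [k < -n] - [k < 0]; so a_k is the sum of e times
    this over the arrows.  Free moves preserve every sum of e F(index) with F 0 = 0.
    Exchanging two adjacent endpoints changes only their two heights, by 1 each,
    hence changes the indices by at most 2 in total, and changing an index by d
    changes [k < -n] for |d| values of k. *)

Require Import Defs.
From mathcomp Require Import all_boot all_order all_algebra.
From mathcomp Require Import zify ring.
Import Order.TTheory GRing.Theory Num.Theory.

Set Implicit Arguments.
Unset Strict Implicit.
Unset Printing Implicit Defensive.

Local Open Scope ring_scope.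

Definition flip (x : letter) : letter := (lab x, ~~ ishead x, pos x).

(** * Heights, indices and weighted sums over arrows *)

Definition height (w : gword) (y : letter) : int :=
  \sum_(x <- take (index y w) w) end_sgn x.

(** For a tail [x], the difference of heights includes the sign of [x] itself, which the last term
    cancels. *)
Definition tail_index (w : gword) (x : letter) : int :=
  height w (flip x) - height w x + bsgn (pos x).

(** Each arrow is counted once, through its tail. Keeping [F] general treats all coefficients of the
    quotient at once. *)
Definition weight (F : int -> int) (w : gword) : int :=
  \sum_(x <- w | ~~ ishead x) bsgn (pos x) * F (arrow_index w (lab x)).

(* Coefficient of t^k in (t^-n - 1) / (t - 1). *)
Definition quot_coef (k n : int) : int :=
  Posz (k < - n)%R - Posz (k < 0)%R.

(** * The involution exchanging the two ends of an arrow *)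

Lemma flipK : involutive flip.
Proof. by case=> [[l h] e]; rewrite /flip /= negbK. Qed.

Lemma flipE l h e : flip (l, h, e) = (l, ~~ h, e).
Proof. by []. Qed.

Lemma ishead_flip x : ishead (flip x) = ~~ ishead x.
Proof. by []. Qed.

Lemma flip_neq x : (flip x == x) = false.
Proof.
by case: x => [[l h] e]; apply/eqP => -[] ; case: h.
Qed.

Lemma end_sgn_flip x : end_sgn (flip x) = - end_sgn x.
Proof. by case: x => [[l []] e]; rewrite /end_sgn /= ?opprK. Qed.

Lemma wf_flip_mem w x : wf_gauss w -> x \in w -> flip x \in w.
Proof. by move=> wfw /wfw []. Qed.

(** A letter and its [flip] are distinct and share a label that occurs only twice, so each occurs
    once. *)
Lemma wf_uniq w : wf_gauss w -> uniq w.
Proof.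
move=> wfw; apply: count_mem_uniq => x.
have [xw|xw] := boolP (x \in w); last by apply/count_memPn.
have [c2 fx] := wfw x xw; rewrite -/(flip x) in fx.
have x1 : (0 < count_mem x w)%N by rewrite -has_count has_pred1.
have f1 : (0 < count_mem (flip x) w)%N by rewrite -has_count has_pred1.
have : (count_mem x w + count_mem (flip x) w <= 2)%N.
  rewrite -c2 -count_predUI [X in (_ + X)%N](_ : _ = 0%N); last first.
    apply/eqP; rewrite -leqn0 leqNgt -has_count; apply/hasPn => y _ /=.
    by apply/andP => -[/eqP ->]; rewrite eq_sym flip_neq.
  rewrite addn0; apply: sub_count => y /=.
  by case/orP=> /eqP ->.
lia.
Qed.

Lemma wf_same_lab w x y : wf_gauss w -> x \in w -> y \in w ->
  lab y = lab x -> y = x \/ y = flip x.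
Proof.
move=> wfw xw yw lxy; have [c2 fx] := wfw x xw.
have [->|nyx] := eqVneq y x; first by left.
have [->|nyf] := eqVneq y (flip x); first by right.
(* Otherwise three distinct letters would carry a label that occurs twice. *)
suff: (3 <= 2)%N by [].
rewrite -{2}c2 -size_filter.
apply: (@uniq_leq_size _ [:: x; flip x; y]).
  rewrite /= !inE negb_or ![x == _]eq_sym [flip x == y]eq_sym.
  by rewrite flip_neq nyx nyf.
move=> z; rewrite !inE mem_filter => /or3P [] /eqP -> /=.
- by rewrite eqxx.
- by rewrite eqxx.
- by rewrite lxy eqxx.
Qed.

Lemma perm_flip w : wf_gauss w -> perm_eq (map flip w) w.
Proof.
move=> wfw; apply: uniq_perm.
- by rewrite (map_inj_uniq (inv_inj flipK)) wf_uniq.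
- exact: wf_uniq.
- move=> x; rewrite -[x in LHS]flipK (mem_map (inv_inj flipK)).
  by apply/idP/idP => /(wf_flip_mem wfw); rewrite ?flipK.
Qed.

(** [flip] permutes the word and negates every sign, so the sum equals its opposite. *)
Lemma wf_sum0 w : wf_gauss w -> \sum_(x <- w) end_sgn x = 0.
Proof.
move=> wfw; have : \sum_(x <- w) end_sgn x = - \sum_(x <- w) end_sgn x.
  rewrite -[LHS](perm_big _ (perm_flip wfw)) big_map -sumrN /=.
  by apply: eq_bigr => x _; rewrite end_sgn_flip.
lia.
Qed.

(** * Heights under concatenation and rotation, and the index formula *)

Lemma height_cat u v y : height (u ++ v) y =
  if y \in u then height u y else \sum_(x <- u) end_sgn x + height v y.
Proof.
rewrite /height index_cat; case: ifP => yu.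
  by rewrite takel_cat // ltnW // index_mem.
by rewrite take_cat ltnNge leq_addr /= addKn big_cat.
Qed.

Lemma height_cons x w y : height (x :: w) y =
  if y == x then 0 else end_sgn x + height w y.
Proof.
rewrite /height /= eq_sym; case: ifP => _; first by rewrite big_nil.
by rewrite big_cons.
Qed.

Lemma wf_perm w w' : perm_eq w w' -> wf_gauss w -> wf_gauss w'.
Proof.
move=> pw wfw x; rewrite -(perm_mem pw) => /wfw [c m].
by rewrite -(permP pw) -(perm_mem pw).
Qed.

Lemma wf_rot k w : wf_gauss w -> wf_gauss (rot k w).
Proof. by apply: wf_perm; rewrite perm_sym perm_rot. Qed.

Lemma height_rot w k : wf_gauss w -> exists c : int, 
  forall y, y \in w -> height (rot k w) y = height w y + c.
Proof.
move=> wfw; have := wf_sum0 wfw; have := wf_uniq wfw.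
rewrite /rot -{1 2 3 6}(cat_take_drop k w).
move: (take k w) (drop k w) => u v.
rewrite cat_uniq big_cat /= => /and3P [_ /hasPn uv _] s0.
(* Letters of [u] gain the sum of [v]; letters of [v] lose the sum of [u], which is the same change
   because the total is 0. *)
exists (\sum_(x <- v) end_sgn x) => y; rewrite mem_cat !height_cat => yw.
have [yu|yu] := boolP (y \in u).
  rewrite ifN; last by apply/negP => /uv /=; rewrite yu.
  by rewrite addrC.
rewrite (negbTE yu) /= in yw; by rewrite yw addrAC s0 add0r.
Qed.

Lemma tail_index_rot w k x : wf_gauss w -> x \in w ->
  tail_index (rot k w) x = tail_index w x.
Proof.
move=> wfw xw; have [c hc] := height_rot k wfw.
by rewrite /tail_index !hc ?wf_flip_mem //; lia.
Qed.

(* Rotating so that the tail comes first removes the wrap-around case. *)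
Lemma arrow_indexE w x : wf_gauss w -> x \in w -> ~~ ishead x ->
  arrow_index w (lab x) = tail_index w x.
Proof.
move=> wfw xw tx.
have onlyx y : y \in w -> (lab y == lab x) && ~~ ishead y -> y = x.
  move=> yw /andP [/eqP ly ty].
  have [//|yf] := wf_same_lab wfw xw yw ly.
  by move: ty; rewrite yf ishead_flip tx.
have onlyf y : y \in w -> (lab y == lab x) && ishead y -> y = flip x.
  move=> yw /andP [/eqP ly ty].
  by have [yf|//] := wf_same_lab wfw xw yw ly; move: tx; rewrite -yf ty.
rewrite -(@tail_index_rot w (index x w) x wfw xw) /arrow_index.
have -> : find (fun y => (lab y == lab x) && ~~ ishead y) w = index x w.
  apply: eq_in_find => y yw; apply/idP/eqP => [/(onlyx y yw) //|->].
  by rewrite eqxx.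
have := @wf_rot (index x w) w wfw.
have := mem_rot (index x w) w.
rewrite (rot_index xw); set r := drop _ _ ++ take _ _ => mr wfr.
have fr : flip x \in r.
  have := wf_flip_mem wfw xw.
  by rewrite -mr inE flip_neq.
rewrite /= (negbTE tx) andbF /=.
have -> : find (fun y => (lab y == lab x) && ishead y) r = index (flip x) r.
  apply: eq_in_find => y yr; apply/idP/eqP => [|->].
    by apply: onlyf; rewrite -mr inE yr orbT.
  by rewrite eqxx ishead_flip.
rewrite /tail_index !height_cons eqxx flip_neq /height.
rewrite {2}/end_sgn (negbTE tx).
by rewrite subr0 addrAC addNr add0r.
Qed.

Lemma weightE F w : wf_gauss w ->
  weight F w = \sum_(x <- w | ~~ ishead x) bsgn (pos x) * F (tail_index w x).
Proof.
move=> wfw; rewrite /weight big_seq_cond [RHS]big_seq_cond.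
by apply: eq_bigr => x /andP [xw tx]; rewrite arrow_indexE.
Qed.

Lemma weight_perm F w w' : wf_gauss w -> perm_eq w w' ->
  {in w, forall x, ~~ ishead x -> tail_index w' x = tail_index w x} ->
  weight F w' = weight F w.
Proof.
move=> wfw pw H; rewrite !weightE //; last exact: wf_perm pw wfw.
rewrite -(perm_big _ pw) /= big_seq_cond [RHS]big_seq_cond.
by apply: eq_bigr => x /andP [xw tx]; rewrite H.
Qed.

Lemma weight_rot F w k : wf_gauss w -> weight F (rot k w) = weight F w.
Proof.
move=> wfw; apply: weight_perm => //; first by rewrite perm_sym perm_rot.
by move=> x xw _; apply: tail_index_rot.
Qed.

(** * Renaming of arrows *)

Section Relabel.
Variables (f : nat -> nat) (f_inj : injective f).
Let g (x : letter) : letter := (f (lab x), ishead x, pos x).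

Lemma relabel_inj : injective g.
Proof.
move=> [[l h] e] [[l' h'] e'].
by rewrite /g /lab /ishead /pos /= => -[/f_inj -> -> ->].
Qed.

Lemma wf_relabel w : wf_gauss (map g w) <-> wf_gauss w.
Proof.
have H x : (count (fun y => lab y == lab x) w = 2%N /\ flip x \in w) <->
  (count (fun y => lab y == lab (g x)) (map g w) = 2%N /\
   flip (g x) \in map g w).
  rewrite (_ : flip (g x) = g (flip x)) // (mem_map relabel_inj) count_map.
  suff -> : count (preim g (fun y => lab y == lab (g x))) w =
    count (fun y => lab y == lab x) w by [].
  by apply: eq_count => y; apply: (inj_eq f_inj).
split=> [wfw x xw|wfw x' /mapP [x xw ->]]; last by apply/H/wfw.
by apply/H; apply: wfw; apply: map_f.
Qed.

Lemma height_relabel w y : height (map g w) (g y) = height w y.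
Proof.
by rewrite /height (index_map relabel_inj) -map_take big_map.
Qed.

Lemma weight_relabel F w : wf_gauss w -> weight F (map g w) = weight F w.
Proof.
move=> wfw; rewrite !weightE //; last exact/wf_relabel.
rewrite big_map; apply: eq_bigr => x _; congr (_ * F _).
by rewrite /tail_index (_ : flip (g x) = g (flip x)) // !height_relabel.
Qed.

End Relabel.

(** * Exchange of adjacent endpoints *)

(** The change in the height of [z] when adjacent [x], [y] become [y], [x]: [x] now has [y] before
    it, and [y] no longer has [x] before it. *)
Definition swap_shift (x y z : letter) : int :=
  (if z == x then end_sgn y else 0) - (if z == y then end_sgn x else 0).

Lemma height_swap u v x y z : uniq (u ++ x :: y :: v) ->
  height (u ++ y :: x :: v) z = height (u ++ x :: y :: v) z + swap_shift x y z.
Proof.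
rewrite cat_uniq /= negb_or => /and3P [_ /andP [xu]].
rewrite negb_or => /andP [yu _].
rewrite inE negb_or => /andP [/andP [xy _] _].
rewrite !height_cat !height_cons /swap_shift.
have [->|zx] := eqVneq z x; first by rewrite (negbTE xu) (negbTE xy); lia.
have [->|zy] := eqVneq z y; first by rewrite (negbTE yu); lia.
by case: ifP => _; lia.
Qed.

Lemma perm_swap (T : eqType) (u v : seq T) x y :
  perm_eq (u ++ x :: y :: v) (u ++ y :: x :: v).
Proof. by rewrite perm_cat2l (perm_catCA [:: x] [:: y]). Qed.

Lemma height_adjacent u v x y : uniq (u ++ x :: y :: v) ->
  height (u ++ x :: y :: v) y = height (u ++ x :: y :: v) x + end_sgn x.
Proof.
rewrite cat_uniq /= negb_or => /and3P [_ /andP [xu]].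
rewrite negb_or => /andP [yu _].
rewrite inE negb_or => /andP [/andP [xy _] _].
rewrite !height_cat (negbTE xu) (negbTE yu) !height_cons !eqxx.
by rewrite eq_sym (negbTE xy); lia.
Qed.

(** * Insertion of arrows: first and second Reidemeister moves *)

Lemma height_insert u B v z : z \notin B -> \sum_(x <- B) end_sgn x = 0 ->
  height (u ++ B ++ v) z = height (u ++ v) z.
Proof. by move=> zB s0; rewrite !height_cat (negbTE zB) s0 add0r. Qed.

(** Both ends are put in front; other positions follow because [wf_gauss] is invariant under
    permutation. *)
Lemma wf_insert w p : lab p \notin labels w ->
  wf_gauss (p :: flip p :: w) <-> wf_gauss w.
Proof.
move=> pw.
have c0 : count (fun y => lab y == lab p) w = 0%N.
  apply/eqP; rewrite -leqn0 leqNgt -has_count; apply/hasPn => y yw.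
  by apply: contra pw => /eqP <-; apply: map_f.
have labN x : x \in w -> (lab p == lab x) = false.
  by move=> xw; apply: contraNF pw => /eqP ->; apply: map_f.
have H x : x \in w ->
  (count (fun y => lab y == lab x) w = 2%N /\ flip x \in w) <->
  (count (fun y => lab y == lab x) (p :: flip p :: w) = 2%N /\
   flip x \in p :: flip p :: w).
  move=> xw; rewrite /= (_ : lab (flip p) = lab p) // labN // !inE.
  have -> : (flip x == p) = false.
    by apply: contraFF (labN _ xw) => /eqP <-.
  have -> // : (flip x == flip p) = false.
  by rewrite (inj_eq (inv_inj flipK)); apply: contraFF (labN _ xw) => /eqP ->.
split=> wfw x xw; first by apply/H => //; apply: wfw; rewrite !inE xw !orbT.
move: xw; rewrite !inE => /or3P [/eqP ->|/eqP ->|xw]; last exact/H/wfw.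
  by split; [rewrite /= eqxx c0|rewrite -/(flip p) eqxx orbT].
by split; [rewrite /= eqxx c0|rewrite -/(flip (flip p)) flipK eqxx].
Qed.

Lemma weight_insert F w w' N : wf_gauss w -> wf_gauss w' ->
  perm_eq w' (N ++ w) -> {in w, height w' =1 height w} ->
  weight F w' = weight F w +
    \sum_(x <- N | ~~ ishead x) bsgn (pos x) * F (tail_index w' x).
Proof.
move=> wfw wfw' pw H; rewrite !weightE // (perm_big _ pw) big_cat /= addrC.
congr (_ + _); rewrite big_seq_cond [RHS]big_seq_cond.
apply: eq_bigr => x /andP [xw _].
by rewrite /tail_index !H // wf_flip_mem.
Qed.

Lemma R1_wf w w' : R1_ins w w' -> wf_gauss w <-> wf_gauss w'.
Proof.
move=> [u [v [l [e [-> [fl H]]]]]].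
rewrite -(@wf_insert (u ++ v) (l, false, e) fl).
have pw : perm_eq ((l, false, e) :: flip (l, false, e) :: u ++ v) w'.
  by case: H => ->; rewrite flipE; apply/permP => p;
    rewrite /= !count_cat /=; lia.
by split; apply: wf_perm => //; rewrite perm_sym.
Qed.

Lemma R1_weight F w w' : F 0 = 0 -> wf_gauss w -> R1_ins w w' ->
  weight F w = weight F w'.
Proof.
move=> F0 wfw H; have wfw' := (R1_wf H).1 wfw.
have uw' := wf_uniq wfw'.
move: H wfw wfw' uw' => [u [v [l [e [-> [fl H]]]]]] wfw wfw' uw'.
rewrite (@weight_insert F (u ++ v) w' [:: (l, false, e); (l, true, e)]) //.
(* The ends of the new arrow are adjacent, so its index is 0 and its term vanishes by [F0]. *)
- rewrite big_cons big_cons big_nil /= (_ : tail_index _ _ = 0); first by lia.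
  rewrite /tail_index flipE /=.
  case: H uw' => -> /= uw'; rewrite (height_adjacent uw') /end_sgn /bsgn /=;
    by case: e {fl wfw wfw' uw'}; ring.
- by case: H => ->; apply/permP => p; rewrite /= !count_cat /=; lia.
- move=> x xw.
  have xl : lab x != l by apply: contra fl => /eqP <-; apply: map_f.
  have E b : (x == (l, b, e)) = false by apply: contraNF xl => /eqP ->.
  by case: H => ->; apply: height_insert; rewrite ?inE ?E // !big_cons big_nil;
    rewrite /end_sgn /=; lia.
Qed.

Lemma R2_wf w w' : R2_ins w w' -> wf_gauss w <-> wf_gauss w'.
Proof.
move=> [u [v [z [a [b [e [-> [ab [fa [fb [S1 [S2 [-> H]]]]]]]]]]]]].
rewrite -(@wf_insert (u ++ v ++ z) (b, false, ~~ e) fb).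
rewrite -(@wf_insert _ (a, false, e)); last first.
  by rewrite /= flipE !inE /= !negb_or ab fa.
have pw : perm_eq [:: (a, false, e), flip (a, false, e), (b, false, ~~ e),
    flip (b, false, ~~ e) & u ++ v ++ z] (u ++ S1 ++ v ++ S2 ++ z).
  rewrite !flipE; apply/permP => p.
  by case: H => [[-> ->]|[[-> ->]|[[-> ->]|[-> ->]]]];
    rewrite /= !count_cat /= !count_cat /=; lia.
by split; apply: wf_perm => //; rewrite perm_sym.
Qed.

Lemma R2_weight F w w' : wf_gauss w -> R2_ins w w' ->
  weight F w = weight F w'.
Proof.
move=> wfw H; have wfw' := (R2_wf H).1 wfw.
have uw' := wf_uniq wfw'.
move: H wfw wfw' uw' =>
  [u [v [z [a [b [e [-> [ab [fa [fb [S1 [S2 [-> H]]]]]]]]]]]]] wfw wfw' uw'.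
rewrite (@weight_insert F (u ++ v ++ z) (u ++ S1 ++ v ++ S2 ++ z)
  [:: (a, false, e); (a, true, e); (b, false, ~~ e); (b, true, ~~ e)]) //.
- rewrite !big_cons big_nil /=.
  (* The two new arrows have opposite signs, so equal indices make their terms cancel. *)
  suff -> : tail_index (u ++ S1 ++ v ++ S2 ++ z) (a, false, e) =
            tail_index (u ++ S1 ++ v ++ S2 ++ z) (b, false, ~~ e).
    by case: (e); rewrite /bsgn /=; ring.
  rewrite /tail_index !flipE /=.
  (* This grouping lets [height_adjacent] apply to [S2] as well as to [S1]. *)
  have E2 : u ++ S1 ++ v ++ S2 ++ z = (u ++ S1 ++ v) ++ S2 ++ z.
    by rewrite -!catA.
  have := uw'; rewrite {1}E2.
  case: H uw' {wfw wfw' E2} => [[-> ->]|[[-> ->]|[[-> ->]|[-> ->]]]] /= uw';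
    move=> /height_adjacent; rewrite -catA /= => ->;
    rewrite (height_adjacent uw') /end_sgn /bsgn /=;
    by case: e {fa fb uw'} => /=; ring.
- apply/permP => p.
  by case: H => [[-> ->]|[[-> ->]|[[-> ->]|[-> ->]]]];
    rewrite /= !count_cat /= !count_cat /=; lia.
- move=> x xw.
  have xa : lab x != a by apply: contra fa => /eqP <-; apply: map_f.
  have xb : lab x != b by apply: contra fb => /eqP <-; apply: map_f.
  have Ea h s : (x == (a, h, s)) = false by apply: contraNF xa => /eqP ->.
  have Eb h s : (x == (b, h, s)) = false by apply: contraNF xb => /eqP ->.
  have [xS1 xS2 s1 s2] : [/\ x \notin S1, x \notin S2,
      \sum_(y <- S1) end_sgn y = 0 & \sum_(y <- S2) end_sgn y = 0].
    by case: H => [[-> ->]|[[-> ->]|[[-> ->]|[-> ->]]]];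
      rewrite !inE !Ea !Eb !big_cons !big_nil /end_sgn /bsgn /=; case: (e).
  rewrite height_insert // !(catA u); exact: height_insert.
Qed.

(** * Third Reidemeister move *)

Definition block_shift (B : seq letter) (z : letter) : int :=
  if B is [:: x; y] then swap_shift x y z else 0.

Lemma height_rev_block u v B z : size B = 2%N -> uniq (u ++ B ++ v) ->
  height (u ++ rev B ++ v) z = height (u ++ B ++ v) z + block_shift B z.
Proof. by case: B => [|x [|y []]] // _ /= uw; rewrite /rev /= height_swap. Qed.

(** The blocks are reversed one at a time. Each shift depends only on its own block, so the shifts
    add up. *)
Lemma height_R3 x1 x2 x3 x4 P Q R z :
  all (fun B => size B == 2%N) [:: P; Q; R] ->
  uniq (x1 ++ P ++ x2 ++ Q ++ x3 ++ R ++ x4) ->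
  height (x1 ++ rev P ++ x2 ++ rev Q ++ x3 ++ rev R ++ x4) z =
  height (x1 ++ P ++ x2 ++ Q ++ x3 ++ R ++ x4) z +
    \sum_(B <- [:: P; Q; R]) block_shift B z.
Proof.
rewrite /= => /and4P [/eqP sP /eqP sQ /eqP sR _] uw.
rewrite !big_cons big_nil.
have uP : uniq (x1 ++ rev P ++ x2 ++ Q ++ x3 ++ R ++ x4).
  rewrite (perm_uniq _ : _ = uniq (x1 ++ P ++ x2 ++ Q ++ x3 ++ R ++ x4)) //.
  by rewrite perm_cat2l perm_cat2r perm_rev.
have EQ A B : x1 ++ A ++ x2 ++ B ++ x3 ++ R ++ x4 =
  (x1 ++ A ++ x2) ++ B ++ x3 ++ R ++ x4 by rewrite -!catA.
have uQ : uniq (x1 ++ rev P ++ x2 ++ rev Q ++ x3 ++ R ++ x4).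
  rewrite (perm_uniq _ : _ = uniq (x1 ++ rev P ++ x2 ++ Q ++ x3 ++ R ++ x4)) //.
  by rewrite !EQ perm_cat2l perm_cat2r perm_rev.
have ER A : x1 ++ rev P ++ x2 ++ rev Q ++ x3 ++ A ++ x4 =
  (x1 ++ rev P ++ x2 ++ rev Q ++ x3) ++ A ++ x4 by rewrite -!catA.
rewrite ER height_rev_block -?ER // EQ height_rev_block -?EQ //.
by rewrite height_rev_block //; ring.
Qed.

Lemma R3_perm w w' : R3_move w w' -> perm_eq w w'.
Proof.
move=> [a [b [c [ea [eb [ec [sT [sM [sB]]]]]]]]].
move=> [_ [_ [_ [x1 [x2 [x3 [x4 [P [Q [R [_ [-> ->]]]]]]]]]]]].
by apply/permP => p; rewrite !count_cat !count_rev.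
Qed.

Lemma R3_weight F w w' : wf_gauss w -> R3_move w w' ->
  weight F w = weight F w'.
Proof.
move=> wfw Hw; apply/esym/weight_perm => //; first exact: R3_perm.
move: Hw => [a [b [c [ea [eb [ec [sT [sM [sB]]]]]]]]].
move=> [/and3P [ab ac bc] [Hab [Hac]]] /=.
move=> [x1 [x2 [x3 [x4 [P [Q [R [pS [Ew ->]]]]]]]]] x xw tx.
set ST := (X in perm_eq _ [:: X; _; _]) in pS.
set SM := (X in perm_eq _ [:: _; X; _]) in pS.
set SB := (X in perm_eq _ [:: _; _; X]) in pS.
have sz : all (fun B => size B == 2%N) [:: P; Q; R].
  by rewrite (perm_all _ pS) /= /ST /SM /SB; case: (sT) (sM) (sB) => [] [] [].
have inw y : y \in flatten [:: ST; SM; SB] -> y \in w.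
  rewrite -(perm_mem (perm_flatten pS)) Ew /= !mem_cat.
  by move=> /or4P [] // ->; rewrite ?orbT.
have uw := wf_uniq wfw; rewrite Ew in uw.
(* As a sum over blocks, the shift does not depend on the order of the three segments on the
   circle. *)
rewrite /tail_index Ew !height_R3 // -Ew !(perm_big _ pS) /=.
(* The index is preserved when head and tail shift equally. With booleans read as signs, the tail
   and head shifts are -eb sT and -ec sM for [a], ea sT and ec sB for [b], -ea sM and -eb sB for
   [c]. They agree by [Hab], [Hac] and the product of the two. *)
suff -> : \sum_(B <- [:: ST; SM; SB]) block_shift B (flip x) =
          \sum_(B <- [:: ST; SM; SB]) block_shift B x by ring.
have taw : (a, false, ea) \in w.
  by apply: inw; rewrite /ST; case: (sT); rewrite !inE eqxx ?orbT.
have tbw : (b, false, eb) \in w.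
  by apply: inw; rewrite /ST; case: (sT); rewrite !inE eqxx ?orbT.
have tcw : (c, false, ec) \in w.
  by apply: inw; rewrite /ST /SM; case: (sT) (sM) => [] [];
    rewrite !inE eqxx ?orbT.
have tail_lab l e : (l, false, e) \in w -> lab x = l -> x = (l, false, e).
  by move=> lw lx; case: (wf_same_lab wfw lw xw lx) tx => -> //.
have ba : b != a by rewrite eq_sym.
have ca : c != a by rewrite eq_sym.
have cb : c != b by rewrite eq_sym.
have nE := (negbTE ab, negbTE ac, negbTE bc, negbTE ba, negbTE ca, negbTE cb).
rewrite !big_cons !big_nil /ST /SM /SB.
have [/(tail_lab _ _ taw) -> |xa] := eqVneq (lab x) a; last first.
have [/(tail_lab _ _ tbw) -> |xb] := eqVneq (lab x) b; last first.
have [/(tail_lab _ _ tcw) -> |xc] := eqVneq (lab x) c; last first.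
(* An arrow outside the triangle has no end in any block, so both of its shifts are 0. *)
- have Ea h s : ((x == (a, h, s)) = false) * ((flip x == (a, h, s)) = false).
    by split; apply: contraNF xa => /eqP E; apply/eqP/(congr1 lab E).
  have Eb h s : ((x == (b, h, s)) = false) * ((flip x == (b, h, s)) = false).
    by split; apply: contraNF xb => /eqP E; apply/eqP/(congr1 lab E).
  have Ec h s : ((x == (c, h, s)) = false) * ((flip x == (c, h, s)) = false).
    by split; apply: contraNF xc => /eqP E; apply/eqP/(congr1 lab E).
  by case: (sT) (sM) (sB) => [] [] []; rewrite /= /swap_shift !(Ea, Eb, Ec).
all: rewrite flipE.
(* What remains is a finite check over the orders and signs allowed by [Hab] and [Hac]. *)
all: move: Hab Hac; clear - nE.
all: case: sT; case: sM; case: sB; case: ea; case: eb; case: ec => //= _ _;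
  by rewrite /swap_shift !xpair_eqE !nE !eqxx /=.
Qed.

(** * Invariance under free moves, in both directions *)

Lemma step_wf w w' : R_step w w' -> wf_gauss w <-> wf_gauss w'.
Proof.
move=> [/R1_wf //|[/R2_wf //|[/R3_perm pw|[[k ->]|[f [fi ->]]]]]].
- by split; apply: wf_perm => //; rewrite perm_sym.
- by split; apply: wf_perm; rewrite ?perm_rot // perm_sym perm_rot.
- by split=> /(wf_relabel fi).
Qed.

Lemma step_weight F w w' : F 0 = 0 -> wf_gauss w -> R_step w w' ->
  weight F w = weight F w'.
Proof.
move=> F0 wfw [|[|[|[[k ->]|[f [fi ->]]]]]].
- exact: R1_weight.
- exact: R2_weight.
- exact: R3_weight.
- by rewrite weight_rot.
- by rewrite (weight_relabel fi).
Qed.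

Lemma free_weight F w w' : F 0 = 0 -> wf_gauss w -> free_move w w' ->
  wf_gauss w' /\ weight F w = weight F w'.
Proof.
move=> F0 wfw [] st; first by split; [apply/(step_wf st)|apply: step_weight].
have wfw' : wf_gauss w' by apply/(step_wf st).
by split=> //; apply/esym/step_weight.
Qed.

(** * Effect of a forbidden detour move *)

Lemma bsgn_norm b : `|bsgn b| = 1.
Proof. by case: b. Qed.

Lemma fd_perm w w' : fd_move w w' -> perm_eq w w'.
Proof. by move=> [u [v [x [y [_ [_ [-> ->]]]]]]]; apply: perm_swap. Qed.

(** Only [x] and [y] can contribute; each occurs at most once and accounts for a shift of size 1. *)
Lemma sum_swap_shift w x y : uniq w -> \sum_(z <- w) `|swap_shift x y z| <= 2.
Proof.
move=> uw; have c1 z : \sum_(i <- w) Posz (i == z) <= 1.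
  rewrite -(big_morph Posz PoszD erefl) lez_nat.
  rewrite -[X in (X <= _)%N](_ : count_mem z w = _);
    last by rewrite -sum1_count big_mkcond.
  by rewrite count_uniq_mem // leq_b1.
have : \sum_(z <- w) `|swap_shift x y z| <=
       \sum_(z <- w) (Posz (z == x) + Posz (z == y)).
  apply: ler_sum => z _; rewrite /swap_shift.
  have en t : `|end_sgn t| = 1.
    by rewrite /end_sgn; case: ishead; rewrite ?normrN bsgn_norm.
  move: (en x) (en y); case: (z == x) (z == y) => [] []; lia.
by move/le_trans; apply; rewrite big_split; apply: lerD (c1 x) (c1 y).
Qed.

Lemma sum_tails_flip (G : letter -> int) w : wf_gauss w ->
  \sum_(x <- w | ~~ ishead x) (G (flip x) + G x) = \sum_(x <- w) G x.
Proof.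
move=> wfw; rewrite big_split /= [RHS](bigID ishead) /=; congr (_ + _).
by rewrite -[RHS](perm_big _ (perm_flip wfw)) big_map.
Qed.

Lemma sum_tail_index_fd w w' : wf_gauss w -> fd_move w w' ->
  \sum_(x <- w | ~~ ishead x) `|tail_index w' x - tail_index w x| <= 2.
Proof.
move=> wfw [u [v [x [y [_ [_ [Ew ->]]]]]]].
have uw := wf_uniq wfw.
apply: le_trans (sum_swap_shift x y uw).
(* Regrouping endpoints into arrows: each index changes by the shift of its head minus that of its
   tail, and the triangle inequality applies. *)
rewrite -(sum_tails_flip (fun z => `|swap_shift x y z|) wfw).
apply: ler_sum => z _; rewrite Ew in uw *.
rewrite /tail_index /= !(height_swap _ uw).
apply: le_trans (ler_normB _ _).
by rewrite le_eqVlt; apply/orP; left; apply/eqP; congr `|_|; ring.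
Qed.

Lemma weight_diff F w w' : wf_gauss w -> perm_eq w w' ->
  `|weight F w| <= `|weight F w'| +
    \sum_(x <- w | ~~ ishead x) `|F (tail_index w' x) - F (tail_index w x)|.
Proof.
move=> wfw pw; have wfw' := wf_perm pw wfw.
rewrite !weightE // -(perm_big _ pw) /=.
set A := \sum_(_ <- _ | _) _; set B := \sum_(_ <- _ | _) _.
have : `|B - A| <= \sum_(x <- w | ~~ ishead x)
   `|F (tail_index w' x) - F (tail_index w x)|.
  rewrite /A /B -sumrB; apply: le_trans (ler_norm_sum _ _ _) _.
  by apply: ler_sum => x _; rewrite -mulrBr normrM bsgn_norm mul1r.
move=> H; rewrite -lerBlDl; apply: le_trans H.
by rewrite distrC; apply: lerB_dist.
Qed.

(** * Summing the change over all coefficients *)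

Lemma sum_window (p q s : int) L : p <= q ->
  \sum_(i < L) `|Posz (Posz i - s < p)%R - Posz (Posz i - s < q)%R| <= q - p.
Proof.
move=> pq.
(* Induction on [L] needs the sharper count of those i < L with p + s <= i < q + s, a difference of
   endpoints clamped to [0, L]. *)
suff : \sum_(i < L) `|Posz (Posz i - s < p)%R - Posz (Posz i - s < q)%R| <=
   Num.max 0 (Num.min (Posz L) (q + s)) - Num.max 0 (Num.min (Posz L) (p + s)).
  lia.
elim: L => [|L IH]; first by rewrite big_ord0; lia.
rewrite big_ord_recr /=; apply: le_trans (lerD IH (lexx _)) _; clear IH; lia.
Qed.

Lemma sum_quot_coef (m n s : int) L :
  \sum_(i < L) `|quot_coef (Posz i - s) m - quot_coef (Posz i - s) n|
    <= `|m - n|.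
Proof.
wlog mn : m n / m <= n => [H|].
  have [/H //|/ltW /H] := leP m n.
  by rewrite distrC; under eq_bigr do rewrite distrC.
(* The terms [k < 0] cancel in the difference, leaving the window between -n and -m. *)
have /(sum_window s L) : - n <= - m by lia.
have -> : - m - - n = `|m - n| by lia.
apply: le_trans; apply: ler_sum => i _; rewrite /quot_coef; lia.
Qed.

Lemma quot_coef0 k : quot_coef k 0 = 0.
Proof. by rewrite /quot_coef oppr0 subrr. Qed.

(** Induction on the sequence of moves: the empty diagram has weight 0, free moves cost nothing, and
    each forbidden detour move costs at most 2. *)
Lemma reach_weight w z n s L : fd_reach w z n -> wf_gauss w -> z = [::] ->
  \sum_(i < L) `|weight (quot_coef (Posz i - s)) w| <= Posz n.*2.
Proof.
elim=> {w z n} [w|w w' z n fm _ IH|w w' z n fm _ IH] wfw z0.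
- by rewrite z0 big1 // => i _; rewrite /weight big_nil normr0.
- have [wfw' _] := free_weight (quot_coef0 0) wfw fm.
  apply: le_trans (IH wfw' z0); apply: ler_sum => i _.
  by have [_ ->] := free_weight (quot_coef0 (Posz i - s)) wfw fm.
- have pw := fd_perm fm.
  have H i : true -> _ := fun _ => weight_diff (quot_coef (Posz i - s)) wfw pw.
  apply: le_trans (ler_sum _ (fun (i : 'I_L) => @H i)) _.
  (* With arrows outside and coefficients inside, each inner sum is at most the change of that
     arrow's index. *)
  rewrite big_split /= exchange_big /=.
  rewrite (_ : Posz n.+1.*2 = Posz n.*2 + 2); last by rewrite doubleS; lia.
  apply: lerD; first exact: IH (wf_perm pw wfw) z0.
  apply: le_trans (sum_tail_index_fd wfw fm).
  by apply: ler_sum => x _; apply: sum_quot_coef.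
Qed.

(** * Identifying the coefficients of the quotient *)

(** This is multiplication by t - 1 read coefficientwise: an arrow of index n contributes its sign
    times [k = -n] - [k = 0]. *)
Lemma affine_coef_weight w k :
  affine_coef w k = weight (quot_coef (k - 1)) w - weight (quot_coef k) w.
Proof.
rewrite /affine_coef /Jn /weight -sumrB -sumrN; case: eqP => [->|k0].
  rewrite !big_mkcondr; apply: eq_bigr => x _ /=; rewrite -mulrBr /quot_coef.
  by case: eqP => i0;
    rewrite -[X in _ = _ * X](_ : - Posz (arrow_index w (lab x) != 0) = _); lia.
rewrite big_mkcondr; apply: eq_bigr => x _ /=; rewrite -mulrBr /quot_coef.
have -> : Posz (k - 1 < - arrow_index w (lab x))%R - Posz (k - 1 < 0)%R -
  (Posz (k < - arrow_index w (lab x))%R - Posz (k < 0)%R) =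
  Posz (arrow_index w (lab x) == - k) by lia.
by case: eqP; rewrite ?mulr1 ?mulr0.
Qed.

Lemma weight_quot_coef_large w : exists K : nat, forall k : int,
  Posz K <= k -> weight (quot_coef k) w = 0.
Proof.
(* Once k is at least every |n|, neither k < -n nor k < 0 can hold. *)
exists (\max_(x <- w) `|arrow_index w (lab x)|%N) => k Kk.
rewrite /weight big_seq_cond big1 // => x /andP [xw _].
have ik : Posz `|arrow_index w (lab x)|%N <= k.
  apply: le_trans Kk; rewrite lez_nat.
  exact: (@leq_bigmax_seq _ w xpredT
    (fun x => `|arrow_index w (lab x)|%N) x xw isT).
rewrite (_ : quot_coef _ _ = 0) ?mulr0 // /quot_coef.
move: (arrow_index _ _) ik => i ik {Kk}; lia.
Qed.

Local Close Scope ring_scope.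

(** A bound for every [n] that reaches the empty diagram bounds the least one, and the indices from
    -M to M carry all nonzero a_k. *)
Theorem theorem1p2 (D : gword) (n : nat) (a : int -> int) (M : nat) :
  wf_gauss D ->
  fd_reach D [::] n ->
  (forall k : int, (Posz M < `|k|)%R -> a k = 0%R) ->
  (forall k : int, affine_coef D k = (a (k - 1) - a k)%R) ->
  (\sum_(i < (M.*2).+1) `|a (Posz i - Posz M)| <= Posz (n.*2))%R.
Proof.
move=> wfD reach a0 aE.
have [K HK] := weight_quot_coef_large D.
(* Both sequences have the same consecutive differences, so their difference is constant. *)
have shift (m : nat) k : (a k - weight (quot_coef k) D =
    a (k + Posz m) - weight (quot_coef (k + Posz m)) D)%R.
  elim: m => [|m IH]; first by rewrite addr0.
  rewrite IH; have := aE (k + Posz m.+1)%R; rewrite affine_coef_weight.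
  by rewrite (_ : (k + Posz m.+1 - 1 = k + Posz m)%R); lia.
have aW k : a k = weight (quot_coef k) D.
  (* Then k + m exceeds both [M] and [K], where both sequences vanish, so the constant is 0. *)
  pose m := (`|k| + M + K + 1)%N.
  apply/eqP; rewrite -subr_eq0 (shift m) a0 ?HK ?subrr // /m; lia.
under eq_bigr do rewrite aW.
exact: reach_weight reach wfD erefl.
Qed.
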